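(* There is an absolute constant $C>0$ such that for every $n\ge1$, $N=2^n$, and every $f:\{0,\dots,N-1\}\to\{0,1\}$ whose number $M$ of matches (indices $i$ with $f(i)=1$) satisfies $1\le M\le N$, the randomized search procedure for an unknown number of matches (which does not use $M$), with parameter $\lambda=8/7$, finds a match using a total expected number of iterations of the partial-diffusion search algorithm at most $C\sqrt{N/M}$; that is, $O(\sqrt{N/M})$ for all $1\le M\le N$.
   Context: Quantum subroutine (partial-diffusion search algorithm). It acts on $n+1$ qubits with basis $|i\rangle\otimes|b\rangle$, $0\le i\le N-1$, $b\in\{0,1\}$. The oracle is $U_f(|i\rangle\otimes|b\rangle)=|i\rangle\otimes|b\oplus f(i)\rangle$. The partial diffusion operator is $D_p=(H^{\otimes n}\otimes I_1)(2|0\rangle\langle 0|-I_{n+1})(H^{\otimes n}\otimes I_1)$, where $H$ is the $2\times2$ Hadamard matrix, $|0\rangle$ is the all-zero basis state of the $n+1$ qubits, and $I_k$ is the $2^k\times 2^k$ identity. One iteration is the application of $D_pU_f$ ($U_f$ first, then $D_p$). Procedure for an unknown number of matches: (1) set $m=1$, $\lambda=8/7$; (2) pick an integer $j$ between $0$ and $m-1$ uniformly at random; (3) run $j$ iterations of $D_pU_f$ on the initial state $\frac1{\sqrt N}\sum_{i=0}^{N-1}|i\rangle\otimes|0\rangle$; (4) measure the first $n$ qubits, obtaining $i$; (5) if $f(i)=1$, output $i$ and stop; (6) otherwise replace $m$ by $\min(\lambda m,\sqrt N)$ and go to step (2). The total number of iterations is the sum of the values $j$ used over all rounds until stopping. 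*)

(* Defs.v *)
From HB Require Import structures.
From mathcomp Require Export all_boot all_order all_algebra.
From mathcomp Require Export complex mxtens.
From mathcomp Require Export all_classical all_reals ereal esum.

Set Implicit Arguments.
Unset Strict Implicit.
Unset Printing Implicit Defensive.

Import Order.TTheory GRing.Theory Num.Theory.

Local Open Scope ring_scope.
Local Open Scope complex_scope.

(** The n+1 qubits live in C^(2^n) (x) C^2, with complex numbers R[i] over the
    reals R.  Tensor products are the Kronecker products of [mxtens]: [A *t B],
    and [A ^t n] for the n-fold power. *)
Section Quantum.
Context {R : realType}.

Definition ketn n (i : 'I_(2 ^ n)) : 'cV[R[i]]_(2 ^ n) := delta_mx i 0.

Definition ketb (b : bool) : 'cV[R[i]]_2 := delta_mx (inord b) 0.

Definition ket n (i : 'I_(2 ^ n)) (b : bool) : 'cV[R[i]]_(2 ^ n * 2) :=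
  ketn i *t ketb b.

Definition hadamard : 'M[R[i]]_2 :=
  ((Num.sqrt 2)^-1)%:C *: \matrix_(i, j) (-1) ^+ (i * j).

Lemma exp2_gt0 n : (0 < 2 ^ n)%N. Proof. by rewrite expn_gt0. Qed.

Definition ket0 n : 'cV[R[i]]_(2 ^ n * 2) := ket (Ordinal (exp2_gt0 n)) false.

(** U_f = sum_(i, b) |i, b (+) f i><i, b|; the kets are real, so that the
    transpose is the bra. *)
Definition oracle n (f : 'I_(2 ^ n) -> bool) : 'M[R[i]]_(2 ^ n * 2) :=
  \sum_i \sum_(b : bool) ket i (b (+) f i) *m (ket i b)^T.

Definition partial_diffusion n : 'M[R[i]]_(2 ^ n * 2) :=
  let HI : 'M[R[i]]_(2 ^ n * 2) := (hadamard ^t n) *t (1%:M : 'M_2) in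
  HI *m (2 *: (ket0 n *m (ket0 n)^T) - 1%:M) *m HI.

Definition initial_state n : 'cV[R[i]]_(2 ^ n * 2) :=
  ((Num.sqrt (2 ^ n)%:R)^-1)%:C *: \sum_i ket i false.

Definition search_state n (f : 'I_(2 ^ n) -> bool) (j : nat) :
    'cV[R[i]]_(2 ^ n * 2) :=
  iter j (fun psi => partial_diffusion n *m (oracle f *m psi))
    (initial_state n).

(** Born rule for measuring the first n qubits only: the probability of i is
    the sum over b of the squared moduli of the amplitudes of |i, b>. *)
Definition measure_prob n (psi : 'cV[R[i]]_(2 ^ n * 2)) (i : 'I_(2 ^ n)) : R :=
  \sum_(b : bool) complex.Re (`|((ket i b)^T *m psi) 0 0| ^+ 2).

Lemma ket_orthonormal n (i i' : 'I_(2 ^ n)) (b b' : bool) :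
  (ket i b)^T *m ket i' b' = ((i == i') && (b == b'))%:R%:M.
Proof.
have eb : (inord b == inord b' :> 'I_2) = (b == b').
  by rewrite -val_eqE /= !inordK; case: b; case: b'.
have -> : (ket i b)^T *m ket i' b' =
    ((ketn i)^T *m ketn i') *t ((ketb b)^T *m ketb b').
  by rewrite -tensmx_mul -!trmx_tens.
rewrite /ketn /ketb.
rewrite !trmx_delta !mul_delta_mx_cond eb.
apply/matrixP => x y; rewrite !ord1 !mxE.
by case: (i == i'); case: (b == b'); rewrite !mxE ?eqxx ?mulr1 ?mul0r ?mulr0.
Qed.

Lemma oracle_ket n (f : 'I_(2 ^ n) -> bool) (i : 'I_(2 ^ n)) (b : bool) :
  oracle f *m ket i b = ket i (b (+) f i).
Proof.
have delta (i' : 'I_(2 ^ n)) (b' : bool) :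
    ket i' (b' (+) f i') *m (ket i' b')^T *m ket i b =
    ((i' == i) && (b' == b))%:R *: ket i (b (+) f i).
  rewrite -mulmxA ket_orthonormal mul_mx_scalar.
  by case: eqP => [->|_]; case: eqP => [->|_]; rewrite /= ?scale0r.
rewrite /oracle mulmx_suml.
under eq_bigr => i' _.
  rewrite mulmx_suml.
  under eq_bigr => b' _ do rewrite delta.
  over.
rewrite (bigD1 i) //= [X in _ + X]big1 ?addr0; last first.
  by move=> i' /negbTE ->; rewrite big1 // => b' _; rewrite scale0r.
rewrite (bigD1 b) //= [X in _ + X]big1 ?addr0; last first.
  by move=> b' /negbTE ->; rewrite andbF scale0r.
by rewrite !eqxx scale1r.
Qed.

End Quantum.

Section Procedure.
Context {R : realType} (n : nat).

(** A terminating execution of the procedure is recorded as the finite sequence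
    of its rounds; a round is the pair of the integer j that was picked and of
    the index i that was measured. *)
Definition round : Type := (nat * 'I_(2 ^ n))%type.
Definition run : Type := seq round.

(** Uniform law on the integers j such that 0 <= j <= m - 1, for a real m >= 1:
    these are the integers 0, ..., truncn (m - 1). *)
Definition pick_prob (m : R) (j : nat) : R :=
  if j%:R <= m - 1 then ((Num.truncn (m - 1)).+1)%:R^-1 else 0.

(** The probability that the procedure, about to start a round with the current
    value m, performs exactly the rounds of s and stops after the last one. *)
Fixpoint run_prob (lambda : R) (f : 'I_(2 ^ n) -> bool) (m : R) (s : run) : R :=
  match s with
  | [::] => 0
  | (j, i) :: s' =>
      pick_prob m j * measure_prob (search_state f j) i *
      (if f i then (s' == [::])%:R
       else run_prob lambda f (Num.min (lambda * m) (Num.sqrt (2 ^ n)%:R)) s')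
  end.

Definition search_prob (lambda : R) (f : 'I_(2 ^ n) -> bool) (s : run) : R :=
  run_prob lambda f 1 s.

Definition outputs_match (f : 'I_(2 ^ n) -> bool) (s : run) : Prop :=
  if s is r :: s' then f (last r s').2 else False.

Definition iterations (s : run) : nat := (\sum_(r <- s) r.1)%N.

(** There are countably many finite runs and all the terms are nonnegative, so
    probabilities and expectations are sums over the type of runs. *)
Definition prob_find_match (lambda : R) (f : 'I_(2 ^ n) -> bool) : \bar R :=
  (\esum_(s in [set s | outputs_match f s]) (search_prob lambda f s)%:E)%E.

Definition expected_iterations (lambda : R) (f : 'I_(2 ^ n) -> bool) : \bar R :=
  (\esum_(s in [set: run]) (search_prob lambda f s * (iterations s)%:R)%:E)%E.

End Procedure.

(* Main.v *)
Require Import Defs.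
From mathcomp Require Import ring lra.

(** In the basis |i>|b>, [D_p] is the reflection about the initial state, so the
    state after [j] iterations stays in the span of three vectors, with
    coefficients given by Chebyshev polynomials of the second kind at
    [y = 1 - M / N = cos theta]: up to [1 / sqrt N], the amplitude is
    [U_j - U_(j-1)] on the non-matches, and [U_j], [- U_(j-1)] on the two ancilla
    values of a match.  A measurement after [j] iterations therefore succeeds with
    probability [(1 - y) (U_j ^ 2 + U_(j-1) ^ 2)].  The identity
    [U_j ^ 2 + U_(j-1) ^ 2 - 2 y U_j U_(j-1) = 1] replaces all trigonometry: it
    bounds this probability below by [(1 - y) / (1 + y)], and its telescoped sum
    shows that the average over [j < floor m] is at least [1 / 7] as soon as
    [m >= u = sqrt (N / M)].  Since [(1 - 1 / 7) * (8 / 7) < 1], the expected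
    cost starting from [m] is bounded by the potential equal to [49 m] for
    [m >= u] and to [64 u - 7 m] for [m < u]. *)

Set Implicit Arguments.
Unset Strict Implicit.
Unset Printing Implicit Defensive.

Import Order.TTheory GRing.Theory Num.Theory.

Local Open Scope ring_scope.

(** * The circuit on real state vectors *)

Section TensorPower.
Variable S : comNzRingType.

Lemma trmx_ntens m n (A : 'M[S]_(m, n)) k : (A ^t k)^T = A^T ^t k.
Proof.
case: k => [|k]; first by rewrite !ntensmx0 trmx1.
elim: k => [|k IH]; first by rewrite !ntensmx1.
by rewrite !ntensmxSS trmx_tens IH.
Qed.

Lemma ntensmx_mul m n p (A : 'M[S]_(m, n)) (B : 'M[S]_(n, p)) k :
  (A ^t k) *m (B ^t k) = (A *m B) ^t k.
Proof.
case: k => [|k]; first by rewrite !ntensmx0 mulmx1.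
elim: k => [|k IH]; first by rewrite !ntensmx1.
by rewrite !ntensmxSS tensmx_mul IH.
Qed.

Lemma tens1mx1 m n : (1%:M : 'M[S]_m) *t (1%:M : 'M[S]_n) = 1%:M.
Proof.
apply/matrixP => i j; case: (mxtens_indexP i) => i0 i1.
case: (mxtens_indexP j) => j0 j1; rewrite tensmxE !mxE.
by rewrite (can_eq (@mxtens_indexK m n)) xpair_eqE -natrM mulnb.
Qed.

Lemma ntens1mx m k : (1%:M : 'M[S]_m) ^t k = 1%:M.
Proof.
case: k => [|k]; first by rewrite ntensmx0.
elim: k => [|k IH]; first by rewrite ntensmx1.
by rewrite ntensmxSS IH tens1mx1.
Qed.

(** Index 0 of the power splits into 0 in every factor. For the Hadamard matrix this makes the image
    of the zero state uniform. *)
Lemma ntensmx_col0 (A : 'M[S]_2) (c : S) k (i : 'I_(2 ^ k)) :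
  (forall i, A i 0 = c) -> (A ^t k) i (Ordinal (exp2_gt0 k)) = c ^+ k.
Proof.
move=> Ac; case: k i => [|k] i.
  have -> : i = 0 :> 'I_1 by exact: ord1.
  by rewrite ntensmx0; apply: etrans (mxE _ _ _ _) _.
elim: k i => [|k IH] i.
  rewrite ntensmx1 expr1 -(Ac i); congr fun_of_matrix; exact: val_inj.
rewrite ntensmxSS; case: (mxtens_indexP i) => i0 i1.
have -> : Ordinal (exp2_gt0 k.+2) =
          mxtens_index (0 : 'I_2, Ordinal (exp2_gt0 k.+1)) by exact: val_inj.
by rewrite tensmxE Ac IH -exprS.
Qed.

Lemma tensmx_suml (I : finType) m n p q (A : I -> 'M[S]_(m, n))
    (B : 'M[S]_(p, q)) :
  (\sum_i A i) *t B = \sum_i (A i *t B).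
Proof.
apply/matrixP => k l; rewrite !mxE !summxE mulr_suml.
by apply: eq_bigr => i _; rewrite !mxE.
Qed.

Lemma tensmxZl m n p q (c : S) (A : 'M[S]_(m, n)) (B : 'M[S]_(p, q)) :
  (c *: A) *t B = c *: (A *t B).
Proof. by apply/matrixP => k l; rewrite !mxE mulrA. Qed.

End TensorPower.

Section Circuit.
Local Open Scope complex_scope.
Context {R : realType}.

Lemma trmx_hadamard : (@hadamard R)^T = hadamard.
Proof. by apply/matrixP => i j; rewrite !mxE mulnC. Qed.

Lemma hadamard_mul : @hadamard R *m hadamard = 1%:M.
Proof.
have E : ((Num.sqrt 2)^-1 : R)%:C * ((Num.sqrt 2)^-1)%:C = 2^-1.
  rewrite -rmorphM -invfM -expr2 sqr_sqrtr //.
  by rewrite fmorphV rmorph_nat.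
apply/matrixP => i j; rewrite !mxE !big_ord_recl big_ord0 !mxE.
rewrite !mulrA [_ * ((-1) ^+ _) * _]mulrAC [X in _ + (X + _)]mulrAC E.
case: i => [[|[|//]] ?]; case: j => [[|[|//]] ?] /=.
all: rewrite ?muln0 ?mul0n ?muln1 ?expr0 ?expr1 ?mulr0n ?mulr1n.
all: rewrite !(mulrN, mulNr, mulr1, addr0, opprK) E ?subrr //; by field.
Qed.

Lemma sqrtr_exp2 n : Num.sqrt ((2 ^ n)%:R) = Num.sqrt 2 ^+ n :> R.
Proof.
elim: n => [|n IH]; first by rewrite expn0 expr0 sqrtr1.
by rewrite expnS natrM sqrtrM // IH exprS.
Qed.

Lemma ntens_hadamard_ketn0 n :
  (hadamard ^t n) *m ketn (Ordinal (exp2_gt0 n)) =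
  ((Num.sqrt (2 ^ n)%:R)^-1 : R)%:C *: \sum_i ketn i.
Proof.
rewrite -colE; apply/matrixP => i j; rewrite !mxE summxE.
rewrite (ntensmx_col0 (c := ((Num.sqrt 2)^-1)%:C)); last first.
  by move=> k; rewrite !mxE muln0 expr0 mulr1.
rewrite (bigD1 i) //= big1 => [|k /negbTE neq]; last first.
  by rewrite !mxE eq_sym neq.
by rewrite !mxE ord1 !eqxx addr0 mulr1 sqrtr_exp2 -exprVn rmorphXn.
Qed.

(** [HI] is a symmetric involution mapping [ket0] to the initial state, so conjugation by it carries
    one reflection to the other. *)
Lemma partial_diffusionE n :
  @partial_diffusion R n =
  2 *: (initial_state n *m (initial_state n)^T) - 1%:M.
Proof.
rewrite /partial_diffusion /=.
set HI := _ *t _.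
have HI_sym : HI^T = HI.
  by rewrite /HI trmx_tens trmx_ntens trmx_hadamard trmx1.
have HI_mul : HI *m HI = 1%:M.
  by rewrite /HI tensmx_mul ntensmx_mul hadamard_mul ntens1mx mulmx1 tens1mx1.
have HI_ket0 : HI *m ket0 n = initial_state n.
  have := tensmx_mul (hadamard ^t n) 1%:M (ketn (Ordinal (exp2_gt0 n)))
                     (@ketb R false).
  rewrite mul1mx ntens_hadamard_ketn0 tensmxZl tensmx_suml.
  exact.
rewrite mulmxBr mulmxBl mulmx1 HI_mul -HI_ket0 trmx_mul HI_sym.
by rewrite -scalemxAr -scalemxAl !mulmxA.
Qed.

Variable n : nat.
Implicit Types (a b : 'I_(2 ^ n) -> R) (f : 'I_(2 ^ n) -> bool).

(** Real amplitudes suffice: [a] goes with ancilla 0, [b] with ancilla 1. *)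
Definition state_of a b : 'cV[R[i]]_(2 ^ n * 2) :=
  \sum_i ((a i)%:C *: ket i false + (b i)%:C *: ket i true).

Lemma eq_state_of a b a' b' :
  a =1 a' -> b =1 b' -> state_of a b = state_of a' b'.
Proof. by move=> ea eb; apply: eq_bigr => i _; rewrite ea eb. Qed.

Lemma oracle_state_of f a b :
  oracle f *m state_of a b =
  state_of (fun i => if f i then b i else a i)
           (fun i => if f i then a i else b i).
Proof.
rewrite mulmx_sumr; apply: eq_bigr => i _.
rewrite mulmxDr -2!scalemxAr 2!oracle_ket.
by case: (f i); first by rewrite addrC.
Qed.

Lemma bra_state_of a b i c :
  (ket i c)^T *m state_of a b = (if c then b i else a i)%:C%:M.
Proof.
rewrite mulmx_sumr (bigD1 i) //= big1 => [|k /negbTE neq].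
  rewrite addr0 mulmxDr -2!scalemxAr 2!ket_orthonormal eqxx.
  rewrite 2!scale_scalar_mx -raddfD /=.
  by case: c; rewrite /= mulr1 mulr0 ?addr0 ?add0r.
rewrite mulmxDr -2!scalemxAr 2!ket_orthonormal eq_sym neq /=.
by rewrite 2!scale_scalar_mx -raddfD /= !mulr0 addr0 raddf0.
Qed.

Lemma measure_prob_state_of a b i :
  measure_prob (state_of a b) i = a i ^+ 2 + b i ^+ 2.
Proof.
have ReX (x : R) : complex.Re (`|x%:C| ^+ 2) = x ^+ 2.
  by rewrite -add_Re2_Im2 /= expr0n addr0.
by rewrite /measure_prob big_bool 2!bra_state_of !mxE !mulr1n 2!ReX addrC.
Qed.

Lemma initial_state_of :
  initial_state n =
  state_of (fun=> (Num.sqrt (2 ^ n)%:R)^-1) (fun=> 0).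
Proof.
rewrite /initial_state scaler_sumr; apply: eq_bigr => i _.
by rewrite rmorph0 scale0r addr0.
Qed.

(** Inversion about the mean on ancilla 0; the ancilla 1 part is orthogonal to the initial state and
    only changes sign. *)
Lemma partial_diffusion_state_of a b :
  partial_diffusion n *m state_of a b =
  state_of (fun i => 2 * ((\sum_k a k) / (2 ^ n)%:R) - a i) (fun i => - b i).
Proof.
rewrite partial_diffusionE mulmxBl mul1mx -scalemxAl -mulmxA.
pose s : R := (Num.sqrt (2 ^ n)%:R)^-1.
have -> : (initial_state n)^T *m state_of a b = (s * \sum_k a k)%:C%:M.
  have -> : (initial_state n)^T = s%:C *: \sum_k (ket k false)^T.
    by rewrite /initial_state -/s linearZ /= linear_sum.
  rewrite -scalemxAl mulmx_suml.
  under eq_bigr => k _ do rewrite bra_state_of.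
  by rewrite -raddf_sum -rmorph_sum /= scale_scalar_mx -rmorphM.
rewrite mul_mx_scalar initial_state_of /state_of -/s.
rewrite !scaler_sumr -sumrB; apply: eq_bigr => i _.
have s2 : s * s = ((2 ^ n)%:R)^-1.
  by rewrite -invfM -expr2 sqr_sqrtr.
rewrite rmorph0 scale0r addr0 !scalerA opprD addrA -scalerBl rmorphN scaleNr.
congr (_ *: _ - _); rewrite rmorphB !rmorphM /= rmorph_nat -s2 rmorphM.
by congr (_ - _); ring.
Qed.

End Circuit.

(** * Chebyshev polynomials and success probabilities *)

(* [chebU y k] is [U_(k-1)(y)], with [U_(-1) = 0]. *)
Fixpoint chebU (R : nzRingType) (y : R) (k : nat) : R :=
  match k with
  | 0 => 0
  | 1 => 1
  | (k''.+1 as k').+1 => 2 * y * chebU y k' - chebU y k''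
  end.

Section Chebyshev.
Context {R : realType}.
Implicit Types (y : R) (k : nat).

Lemma chebUSS y k : chebU y k.+2 = 2 * y * chebU y k.+1 - chebU y k.
Proof. by []. Qed.

(** For fixed [chebU y k.+1], its neighbours [chebU y k] and [chebU y k.+2] are the two roots of one
    monic quadratic, with sum [2 * y * chebU y k.+1]; hence the form keeps its value. *)
Lemma chebU_invariant y k :
  chebU y k.+1 ^+ 2 + chebU y k ^+ 2 - 2 * y * chebU y k.+1 * chebU y k = 1.
Proof.
elim: k => [|k IH]; first by rewrite /=; ring.
by rewrite chebUSS -[RHS]IH; ring.
Qed.

Lemma sum_sqr_chebU y k :
  (1 - y ^+ 2) * \sum_(j < k) (chebU y j.+1 ^+ 2 + chebU y j ^+ 2) =
  k%:R - y * (chebU y k * (chebU y k.+1 - y * chebU y k)).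
Proof.
elim: k => [|k IH]; first by rewrite big_ord0 /=; ring.
rewrite big_ord_recr /= mulrDr IH -/(chebU y k.+1) -/(chebU y k.+2) chebUSS.
by have := chebU_invariant y k; rewrite -natr1; lra.
Qed.

(* The product squared here is [sin (2 k theta) / (2 sin theta)] for
   [y = cos theta]. *)
Lemma sqr_chebU_mul_le y k :
  (1 - y ^+ 2) * (chebU y k * (chebU y k.+1 - y * chebU y k)) ^+ 2 <= 1 / 4.
Proof.
have := chebU_invariant y k.
set v := chebU y k; set w := chebU y k.+1 => inv.
(* With [y = cos theta], this is cos^2 = 1 - sin^2 at the angle [k theta]. The goal then reads
   [x (1 - x) <= 1 / 4] for [x = (1 - y ^ 2) v ^ 2]. *)
have E : (w - y * v) ^+ 2 = 1 - (1 - y ^+ 2) * v ^+ 2 by lra.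
rewrite exprMn E mulrA.
by have := sqr_ge0 ((1 - y ^+ 2) * v ^+ 2 - 1 / 2); lra.
Qed.

Definition success y j : R := (1 - y) * (chebU y j.+1 ^+ 2 + chebU y j ^+ 2).

(** Adding [y (w + v) ^ 2 >= 0] to the invariant gives [1 <= (1 + y) (w ^ 2 + v ^ 2)], uniformly in
    [j]. *)
Lemma success_ge y j : 0 <= y < 1 -> (1 - y) / (1 + y) <= success y j.
Proof.
move=> /andP[y0 y1]; rewrite /success ler_pM2l ?subr_gt0 //.
rewrite -[(1 + y)^-1]mul1r ler_pdivrMr; last lra.
have := chebU_invariant y j; set w := chebU y j.+1; set v := chebU y j => inv.
rewrite -{1}inv; have : 0 <= y * (w + v) ^+ 2 by rewrite mulr_ge0 ?sqr_ge0.
by nra.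
Qed.

Definition avg_success y k : R := k%:R^-1 * \sum_(j < k) success y j.

Lemma avg_success_ge y k c :
  (0 < k)%N -> (forall j, c <= success y j) -> c <= avg_success y k.
Proof.
move=> k0 cle; rewrite ler_pdivlMl ?ltr0n //.
have -> : k%:R * c = \sum_(j < k) c by rewrite sumr_const card_ord mulr_natl.
exact: ler_sum.
Qed.

Lemma avg_success_ge17 y k : 0 <= y < 1 ->
  49 / 100 <= k%:R ^+ 2 * (1 - y ^+ 2) -> 1 / 7 <= avg_success y k.
Proof.
move=> /andP[y0 y1] hk.
have y2 : 0 < 1 - y ^+ 2 by nra.
have k0 : 0 < k%:R :> R.
  by rewrite ltr0n lt0n; apply: contraTneq hk => ->; rewrite -ltNge; lra.
have := sqr_chebU_mul_le y k; have := sum_sqr_chebU y k.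
set X := _ * (_ - _); set S := \sum_(_ < _) _ => sumE X2.
(* Otherwise [(1 - y ^ 2) X ^ 2] would exceed [(25 / 49) (49 / 100) = 1 / 4]. What remains of
   [k - y X] is at least [2 k / 7], and dividing by [1 + y <= 2] leaves [k / 7]. *)
have Xk : X <= 5 / 7 * k%:R.
  rewrite leNgt; apply/negP => lt.
  have : (5 / 7 * k%:R) ^+ 2 < X ^+ 2.
    by rewrite ltr_pXn2r // ?nnegrE; nra.
  rewrite -(ltr_pM2l y2); nra.
rewrite /avg_success ler_pdivlMl // /success -mulr_sumr -/S.
have ES : (1 + y) * ((1 - y) * S) = k%:R - y * X by rewrite -sumE; ring.
have : 2 / 7 * k%:R <= (1 + y) * ((1 - y) * S).
  by rewrite ES; nra.
have : 0 <= (1 - y) * S.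
  apply: mulr_ge0; first lra.
  by apply: sumr_ge0 => j _; rewrite addr_ge0 ?sqr_ge0.
by nra.
Qed.

(* Here [t = M / N] and [k = floor m].  Rounding [m] down loses too much when
   [t >= 1 / 4], but then every single [j] already succeeds often enough. *)
Lemma avg_success_floor_ge (t m : R) (k : nat) : 0 < t <= 1 -> 1 <= m ->
  1 <= m ^+ 2 * t -> (0 < k)%N -> m < k.+1%:R -> 1 / 7 <= avg_success (1 - t) k.
Proof.
move=> /andP[t0 t1] m1 mt k0 mk.
have ty : 0 <= 1 - t < 1 by lra.
have [t4|t4] := leP (1 / 4) t.
  (* The bound of [success_ge] is [t / (2 - t)], which equals [1 / 7] at [t = 1 / 4]. *)
  apply: avg_success_ge => // j; apply: le_trans (success_ge j ty).
  by rewrite ler_pdivlMr; lra.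
apply: avg_success_ge17 => //.
(* Now [k >= 2], so rounding costs at most a factor [3 / 2]: [k ^ 2 t >= 4 / 9], and
   [1 - y ^ 2 = t (2 - t)] with [2 - t > 7 / 4]. *)
have m2 : 2 < m.
  rewrite ltNge; apply/negP => ml; have : m ^+ 2 <= 4 by nra.
  move: (m ^+ 2) mt => q; nra.
have k2 : (2 <= k)%N.
  by have := lt_trans m2 mk; rewrite ltr_nat ltnS.
have {k0}k2R : 2 <= k%:R :> R by rewrite ler_nat.
move: mk; rewrite -natr1 => mk.
have mk32 : m <= 3 / 2 * k%:R by lra.
have : m ^+ 2 <= 9 / 4 * k%:R ^+ 2 by nra.
set q := k%:R ^+ 2 => mq.
have : 4 / 9 <= q * t by nra.
nra.
Qed.

Lemma success_ge0 (y : R) j : y <= 1 -> 0 <= success y j.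
Proof. by move=> y1; rewrite mulr_ge0 ?subr_ge0 ?addr_ge0 ?sqr_ge0. Qed.

(** The complement, the chance of measuring a non-match, is [y] times a square. *)
Lemma success_le1 (y : R) j : 0 <= y -> success y j <= 1.
Proof.
move=> y0; rewrite -subr_ge0.
suff -> : 1 - success y j = y * (chebU y j.+1 - chebU y j) ^+ 2.
  by rewrite mulr_ge0 ?sqr_ge0.
by rewrite -{1}(chebU_invariant y j) /success; ring.
Qed.

Lemma mean_ord_le (k : nat) (F : nat -> R) c :
  (0 < k)%N -> (forall j, (j < k)%N -> F j <= c) ->
  k%:R^-1 * \sum_(j < k) F j <= c.
Proof.
move=> k0 Fc; rewrite ler_pdivrMl ?ltr0n //.
have -> : k%:R * c = \sum_(j < k) c by rewrite sumr_const card_ord mulr_natl.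
by apply: ler_sum => j _; exact: Fc.
Qed.

Lemma avg_success_le1 (y : R) k :
  (0 < k)%N -> 0 <= y -> avg_success y k <= 1.
Proof. by move=> k0 y0; apply: mean_ord_le => // j _; exact: success_le1. Qed.

Lemma mean_failure (y : R) k : (0 < k)%N ->
  k%:R^-1 * \sum_(j < k) (1 - success y j) = 1 - avg_success y k.
Proof.
move=> k0; rewrite sumrB sumr_const card_ord mulrBr mulVf //.
by rewrite pnatr_eq0 -lt0n.
Qed.

End Chebyshev.

(** * The state after [j] iterations *)

Section SearchState.
Context {R : realType} (n : nat) (f : 'I_(2 ^ n) -> bool).

Definition match_ratio : R := #|[set i | f i]%SET|%:R / (2 ^ n)%:R.

Lemma natr_exp2_gt0 : 0 < (2 ^ n)%:R :> R.
Proof. by rewrite ltr0n expn_gt0. Qed.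

Lemma sum_if_match (x z : R) :
  \sum_i (if f i then x else z) =
  (2 ^ n)%:R * (match_ratio * x + (1 - match_ratio) * z).
Proof.
have cardN : (#|[set i | f i]%SET| + #|[pred i | ~~ f i]| = 2 ^ n)%N.
  by rewrite cardsE (cardC f) card_ord.
rewrite (bigID f) /=.
under eq_bigr => i fi do rewrite fi.
under [X in _ + X]eq_bigr => i /negbTE fi do rewrite fi.
rewrite !sumr_const -[x *+ _]mulr_natl -[z *+ _]mulr_natl -(cardsE f).
rewrite /match_ratio.
have := natr_exp2_gt0; move: cardN => /(congr1 (fun k => k%:R : R)) /=.
rewrite natrD; set M := #|_|%:R; set N := (2 ^ n)%:R; set M' := #|_|%:R.
by move=> <- N0; field; rewrite gt_eqF.
Qed.

(** The oracle swaps the two amplitudes of each match; the ancilla 0 mean becomes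
    [s (y U_j - U_(j-1))], and inversion about it is the Chebyshev recurrence. *)
Lemma search_stateE j :
  let y := 1 - match_ratio in
  let s := (Num.sqrt (2 ^ n)%:R)^-1 in
  search_state f j =
  state_of (fun i => if f i then s * chebU y j.+1
                     else s * (chebU y j.+1 - chebU y j))
           (fun i => if f i then - (s * chebU y j) else 0).
Proof.
move=> y s; rewrite /search_state; elim: j => [|j IH].
  rewrite initial_state_of -/s; apply: eq_state_of => i /=.
    by rewrite subr0 mulr1 if_same.
  by rewrite mulr0 oppr0 if_same.
rewrite iterS IH oracle_state_of partial_diffusion_state_of.
have -> : (\sum_k (if f k then if f k then - (s * chebU y j) else 0
                   else if f k then s * chebU y j.+1
                        else s * (chebU y j.+1 - chebU y j))) / (2 ^ n)%:R =
          s * (y * chebU y j.+1 - chebU y j).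
  transitivity ((\sum_k (if f k then - (s * chebU y j)
                         else s * (chebU y j.+1 - chebU y j))) / (2 ^ n)%:R).
    by congr (_ / _); apply: eq_bigr => k _; case: (f k).
  rewrite sum_if_match mulrC mulKf ?gt_eqF ?natr_exp2_gt0 // /y; ring.
apply: eq_state_of => i; rewrite ?chebUSS; case: (f i); ring.
Qed.

Lemma measure_prob_search j i :
  let y := 1 - match_ratio in
  measure_prob (search_state f j) i =
  (2 ^ n)%:R^-1 * (if f i then chebU y j.+1 ^+ 2 + chebU y j ^+ 2
                   else (chebU y j.+1 - chebU y j) ^+ 2).
Proof.
move=> y; rewrite search_stateE measure_prob_state_of -/y.
have s2 : (Num.sqrt (2 ^ n)%:R)^-1 ^+ 2 = (2 ^ n)%:R^-1 :> R.
  by rewrite exprVn sqr_sqrtr // ler0n.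
by case: (f i); rewrite ?sqrrN ?expr0n ?addr0 !exprMn s2 //; ring.
Qed.

Lemma measure_prob_ge0 j i : 0 <= measure_prob (R := R) (search_state f j) i.
Proof.
rewrite measure_prob_search mulr_ge0 ?invr_ge0 ?ler0n //.
by case: (f i); rewrite ?addr_ge0 ?sqr_ge0.
Qed.

(** Reduces a measurement to a biased coin when the continuation depends on [i] only through
    [f i]. *)
Lemma sum_measure_if j (x z : R) :
  \sum_i measure_prob (search_state f j) i * (if f i then x else z) =
  success (1 - match_ratio) j * x + (1 - success (1 - match_ratio) j) * z.
Proof.
set y := 1 - match_ratio; have inv := chebU_invariant y j.
under eq_bigr => i _ do rewrite measure_prob_search -/y.
transitivity (\sum_i (if f i
    then (2 ^ n)%:R^-1 * (chebU y j.+1 ^+ 2 + chebU y j ^+ 2) * x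
    else (2 ^ n)%:R^-1 * (chebU y j.+1 - chebU y j) ^+ 2 * z)).
  by apply: eq_bigr => i _; case: (f i).
rewrite sum_if_match.
have -> : 1 - success y j = y * (chebU y j.+1 - chebU y j) ^+ 2.
  by rewrite /success -{1}inv; ring.
rewrite /success /y; field.
by rewrite gt_eqF ?natr_exp2_gt0.
Qed.

End SearchState.

(** * Sums over runs *)

Section ShortRuns.
Context {n : nat}.

(** At most [L] rounds, all picks below [B]: a finite exhaustion of the runs whose recursion follows
    that of [run_prob]. *)
Fixpoint short_runs (B L : nat) : seq (run n) :=
  if L is L'.+1 then
    [::] :: [seq r :: s | r <- [seq (j, i) | j <- iota 0 B, i <- enum 'I_(2 ^ n)],
                          s <- short_runs B L']
  else [:: [::]].

Lemma mem_short_runs B L (s : run n) :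
  (s \in short_runs B L) = (size s <= L)%N && all (fun r => r.1 < B)%N s.
Proof.
elim: L s => [|L IH] [|[j i] s] //=.
rewrite inE /= ltnS andbCA -IH.
apply/allpairsP/andP => [[[[j' i'] s'] /= [/allpairsP[[j0 i0] /= [+ _ [-> ->]]]]]|].
  by rewrite mem_iota add0n /= => jB s'L [-> _ ->].
move=> [jB sL]; exists ((j, i), s); split => //=.
by apply/allpairsP; exists (j, i); rewrite mem_iota mem_enum.
Qed.

Lemma uniq_short_runs B L : uniq (short_runs B L).
Proof.
elim: L => [//|L IH] /=; apply/andP; split.
  by apply/allpairsP => -[[r s] /= []].
apply: allpairs_uniq => //; last by move=> [r s] [r' s'] _ _ /= [-> ->].
apply: allpairs_uniq; rewrite ?iota_uniq ?enum_uniq //.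
by move=> [j i] [j' i'] _ _ /= [-> ->].
Qed.

(** The lower bound [b] lets later estimates assume [B] large enough for every pick. *)
Lemma short_runs_cover (r : seq (run n)) b :
  exists B L, (b <= B)%N /\ {subset r <= short_runs B L}.
Proof.
elim: r => [|s r [B [L [bB rs]]]]; first by exists b, 0%N.
exists (maxn B (\max_(x <- s) x.1).+1), (maxn L (size s)); split.
  by rewrite leq_max bB.
move=> s'; rewrite inE mem_short_runs => /predU1P[->|/rs].
  rewrite leq_maxr /=; apply/allP => x xs.
  rewrite leq_max ltnS; apply/orP; right.
  exact: (@leq_bigmax_seq _ _ _ (fun x : round n => x.1) _ xs).
rewrite mem_short_runs leq_max => /andP[-> /=] /allP sB.
by apply/allP => x /sB xB; rewrite leq_max xB.
Qed.

Lemma esum_short_runs_le (R : realType) (S : set (run n)) (g : run n -> R) c b :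
  (forall s, 0 <= g s) ->
  (forall B L, (b <= B)%N -> \sum_(s <- short_runs B L) g s <= c) ->
  (\esum_(s in S) (g s)%:E <= c%:E)%E.
Proof.
move=> g0 gc; apply: ge_ereal_sup => _ [X [finX _] <-].
have /finite_seqP[r Xr] := finX; have [B [L [bB rBL]]] := short_runs_cover r b.
apply: le_trans (_ : (\sum_(s \in [set` short_runs B L]) (g s)%:E <= _)%E).
  apply: lee_fsum_nneg_subset => //.
  - exact: finite_seq.
  - by move=> s; rewrite Xr !inE => /rBL.
  - by move=> s _; rewrite lee_fin.
by rewrite -fsbig_seq ?uniq_short_runs // sumEFin lee_fin gc.
Qed.

(** Runs outside [S] contribute 0, so the list may be cut down to a finite subset of [S]. *)
Lemma esum_short_runs_ge (R : realType) (S : set (run n)) (g : run n -> R) B L :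
  (forall s, ~ S s -> g s = 0) ->
  ((\sum_(s <- short_runs B L) g s)%:E <= \esum_(s in S) (g s)%:E)%E.
Proof.
move=> g0; apply: esum_ge; exists ([set` short_runs B L] `&` S)%classic.
  by split; [apply: finite_setIl; exact: finite_seq | exact: subIsetr].
rewrite -sumEFin fsbig_seq ?uniq_short_runs //.
rewrite [X in (_ <= X)%E](fsbig_widen _ [set` short_runs B L]%classic) //.
by move=> s /= [sBL /not_andP[//|/g0 ->]].
Qed.

End ShortRuns.

(** * Recursion on the number of rounds *)

Section Procedure.
Context {R : realType} (n : nat) (f : 'I_(2 ^ n) -> bool).

Let y : R := 1 - match_ratio f.
Let sqrtN : R := Num.sqrt (2 ^ n)%:R.

(** The number of equally likely values of [j]; it is [floor m] when [m >= 1]. *)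
Definition picks (m : R) : nat := (Num.truncn (m - 1)).+1.

Lemma sum_pick_prob (m : R) B (F : nat -> R) : 1 <= m -> (picks m <= B)%N ->
  \sum_(j < B) pick_prob m j * F j = (picks m)%:R^-1 * \sum_(j < picks m) F j.
Proof.
move=> m1 mB; rewrite (big_ord_widen _ _ mB) mulr_sumr [RHS]big_mkcond /=.
apply: eq_bigr => j _; rewrite /pick_prob ltnS truncn_ge_nat ?subr_ge0 //.
by case: ifP => _; rewrite ?mul0r.
Qed.

Lemma picks_le (m : R) j : 1 <= m -> (j < picks m)%N -> j%:R <= m - 1.
Proof. by move=> m1; rewrite ltnS truncn_ge_nat ?subr_ge0. Qed.

Lemma lt_picksS (m : R) : m < (picks m).+1%:R.
Proof. by rewrite -natr1 -ltrBlDr; exact: truncnS_gt. Qed.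

Section Growth.
Variable lambda : R.
Hypothesis lambda1 : 1 <= lambda.

Let next (m : R) : R := Num.min (lambda * m) sqrtN.

Lemma sqrtN_ge1 : 1 <= sqrtN.
Proof. by rewrite -sqrtr1 ler_sqrt ?ler0n // ler1n expn_gt0. Qed.

Lemma next_range m : 1 <= m <= sqrtN -> 1 <= next m <= sqrtN.
Proof.
move=> /andP[m1 _]; rewrite le_min sqrtN_ge1 ge_min lexx orbT !andbT.
by rewrite -[1]mul1r ler_pM.
Qed.

(** The cap on [m] lets a single [B] serve all rounds. *)
Lemma picks_bounded (m : R) B : m <= sqrtN -> (Num.truncn sqrtN < B)%N ->
  (picks m <= B)%N.
Proof.
move=> mN; apply: leq_trans; rewrite ltnS le_truncn //.
by apply: le_trans mN; rewrite lerBlDr lerDl.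
Qed.

Lemma run_prob_ge0 m s : 0 <= run_prob lambda f m s.
Proof.
elim: s m => [|[j i] s IH] m //=; rewrite !mulr_ge0 ?measure_prob_ge0 //.
  by rewrite /pick_prob; case: ifP => // _; rewrite invr_ge0 ler0n.
by case: (f i).
Qed.

Lemma run_prob_outputs m s : ~ outputs_match f s -> run_prob lambda f m s = 0.
Proof.
case: s => [//|r s]; elim: s r m => [|r' s IH] [j i] m /=.
  by case: (f i) => // _; rewrite mulr0.
by move=> nf; case: (f i); rewrite ?mulr0 // [X in _ * X]IH ?mulr0.
Qed.

(** First-step analysis, with a general [g] so as to serve both [mass] and [cost]. *)
Lemma sum_short_runs (g : run n -> R) m B L :
  \sum_(s <- short_runs B L.+1) run_prob lambda f m s * g s =
  \sum_(j < B) pick_prob m j * \sum_i measure_prob (search_state f j) i *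
    (if f i then g [:: (val j, i)]
     else \sum_(s <- short_runs B L)
            run_prob lambda f (next m) s * g ((val j, i) :: s)).
Proof.
rewrite big_cons /= mul0r add0r big_allpairs_dep big_allpairs_dep.
rewrite -(big_mkord xpredT (fun j => pick_prob m j *
  \sum_i measure_prob (search_state f j) i *
    (if f i then g [:: (j, i)]
     else \sum_(s <- short_runs B L)
            run_prob lambda f (next m) s * g ((j, i) :: s)))).
rewrite /index_iota subn0; apply: eq_bigr => j _.
rewrite mulr_sumr big_enum /=; apply: eq_bigr => i _.
rewrite -!/(short_runs B L); move: (measure_prob _ i) => P.
case: ifP => fi; last first.
  by rewrite !mulr_sumr; apply: eq_bigr => s _; rewrite !mulrA.
(* After a match, only the empty continuation has nonzero weight. *)
rewrite (bigD1_seq [::]) ?uniq_short_runs ?mem_short_runs //=.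
rewrite big1 => [|s /negbTE ->]; last by rewrite mulr0 mul0r.
by rewrite addr0 mulr1 mulrA.
Qed.

Definition mass m B L : R :=
  \sum_(s <- short_runs B L) run_prob lambda f m s.

Definition cost m B L : R :=
  \sum_(s <- short_runs B L) run_prob lambda f m s * (iterations s)%:R.

Variable B : nat.
Hypothesis ltB : (Num.truncn sqrtN < B)%N.
Hypothesis y01 : 0 <= y < 1.

Lemma massS m L : 1 <= m <= sqrtN ->
  1 - mass m B L.+1 =
  (1 - avg_success y (picks m)) * (1 - mass (next m) B L).
Proof.
move=> /andP[m1 mN].
have E : mass m B L.+1 =
    \sum_(s <- short_runs B L.+1) run_prob lambda f m s * 1.
  by apply: eq_bigr => s _; rewrite mulr1.
rewrite E sum_short_runs.
have EL : \sum_(s <- short_runs B L) run_prob lambda f (next m) s * 1 =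
          mass (next m) B L by apply: eq_bigr => s _; rewrite mulr1.
under eq_bigr => j _ do rewrite EL sum_measure_if -/y mulr1.
rewrite (sum_pick_prob (fun j => success y j + (1 - success y j) *
  mass (next m) B L)) ?picks_bounded //.
rewrite big_split /= -mulr_suml mulrDr mulrA mean_failure // -/(avg_success _ _).
by ring.
Qed.

(** Each round succeeds with probability at least [(1 - y) / (1 + y)] whatever [m] is, so the
    unfinished mass decays geometrically. *)
Lemma mass_range m L : 1 <= m <= sqrtN ->
  0 <= 1 - mass m B L <= (1 - (1 - y) / (1 + y)) ^+ L.
Proof.
have [y0 y1] := andP y01.
elim: L m => [|L IH] m mR.
  by rewrite expr0 /mass big_seq1 /= subr0 ler01 lexx.
have [m'0 m'1] := andP (IH _ (next_range mR)).
have p1 := avg_success_le1 (ltn0Sn (Num.truncn (m - 1))) y0.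
rewrite massS // exprS; apply/andP; split.
  by rewrite mulr_ge0 // subr_ge0.
rewrite ler_pM // ?subr_ge0 // lerD2l lerN2.
by apply: avg_success_ge => // j; exact: success_ge.
Qed.

Lemma mass_le1 m L : 1 <= m <= sqrtN -> mass m B L <= 1.
Proof. by move=> mR; have /andP[+ _] := mass_range L mR; rewrite subr_ge0. Qed.

(** Only an inequality: each pick is bounded by [m - 1], and runs not finished in time are not
    counted, so the first pick has total weight at most 1. *)
Lemma costS m L : 1 <= m <= sqrtN ->
  cost m B L.+1 <=
  (m - 1) + (1 - avg_success y (picks m)) * cost (next m) B L.
Proof.
move=> mR; have [m1 mN] := andP mR; have [y0 y1] := andP y01.
rewrite /cost sum_short_runs.
have EL j i : \sum_(s <- short_runs B L) run_prob lambda f (next m) s *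
    (iterations ((j, i) :: s : run n))%:R =
    j%:R * mass (next m) B L + cost (next m) B L.
  rewrite mulr_sumr -big_split; apply: eq_bigr => s _ /=.
  by rewrite /iterations big_cons natrD; ring.
have E1 j i : (iterations ([:: (j, i)] : run n))%:R = j%:R :> R.
  by rewrite /iterations big_seq1.
under eq_bigr => j _.
  under eq_bigr => i _ do rewrite EL E1.
  rewrite sum_measure_if -/y; over.
rewrite (sum_pick_prob (fun j => success y j * j%:R + (1 - success y j) *
  (j%:R * mass (next m) B L + cost (next m) B L))) ?picks_bounded //.
rewrite -mean_failure // -mulrA mulr_suml.
rewrite -lerBlDr -mulrBr -sumrB.
apply: (mean_ord_le (F := fun j => success y j * j%:R + (1 - success y j) *
  (j%:R * mass (next m) B L + cost (next m) B L) -
  (1 - success y j) * cost (next m) B L)) => // j jm.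
apply: le_trans (picks_le m1 jm).
have : (1 - success y j) * (j%:R * mass (next m) B L) <=
       (1 - success y j) * j%:R.
  rewrite ler_wpM2l ?subr_ge0 ?success_le1 // ler_piMr ?ler0n //.
  exact: mass_le1 (next_range mR).
by lra.
Qed.

End Growth.

Lemma cost_potential u m B L :
  (Num.truncn sqrtN < B)%N -> 0 <= y < 1 ->
  1 <= u <= sqrtN -> u ^+ 2 * match_ratio f = 1 -> 1 <= m <= sqrtN ->
  cost (8 / 7) m B L <= if u <= m then 49 * m else 64 * u - 7 * m.
Proof.
move=> ltB y01 /andP[u1 uN] ut; have [y0 y1] := andP y01.
have l1 : 1 <= 8 / 7 :> R by lra.
elim: L m => [|L IH] m mR; have [m1 mN] := andP mR.
  rewrite /cost big_seq1 /= mul0r; case: (leP u m) => um; first by lra.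
  by lra.
apply: le_trans (costS l1 ltB y01 _ mR) _.
have p1 := avg_success_le1 (ltn0Sn (Num.truncn (m - 1))) y0.
rewrite -/(picks m) in p1.
have := IH _ (next_range l1 mR).
set m' := Num.min _ _; set p := avg_success _ _ in p1 *; set c := cost _ _ _ _.
have m'le : m' <= 8 / 7 * m by rewrite ge_min lexx.
have [um|mu] := leP u m.
  (* Here [c <= 49 m' <= 56 m], and [(m - 1) + (6 / 7) 56 m <= 49 m]. *)
  have um' : u <= m' by rewrite le_min uN andbT; lra.
  rewrite um' => cm'.
  have p17 : 1 / 7 <= p.
    have -> : p = avg_success (1 - match_ratio f) (picks m) by [].
    apply: (@avg_success_floor_ge _ _ m) => //; last exact: lt_picksS.
      by move: y0 y1; rewrite /y; lra.
    rewrite -ut ler_wpM2r //; last by rewrite ler_pXn2r // nnegrE; lra.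
    by move: y1; rewrite /y; lra.
  have : (1 - p) * c <= (1 - p) * (56 * m) by rewrite ler_wpM2l //; lra.
  by nra.
have p0 : 0 <= p.
  by rewrite /p avg_success_ge // => j; rewrite success_ge0 // ltW.
(* If [m] crosses [u] in this round, [m + 56 m = 57 m <= 64 u - 7 m] since [m < u]; [p >= 0]
   suffices below [u]. *)
have [um'|m'u] := leP u m' => cm'.
  have : (1 - p) * c <= (1 - p) * (56 * m) by rewrite ler_wpM2l //; lra.
  by nra.
(* Below [u] the cap is inactive. The potential at [m'] is [64 u - 8 m], and its drop by [m] pays
   for the round. *)
have Em' : m' = 8 / 7 * m.
  move: m'u; rewrite /m' minEle; case: ifP => // _.
  by rewrite ltNge uN.
move: cm'; rewrite Em' => cm'.
have : (1 - p) * c <= (1 - p) * (64 * u - 8 * m) by rewrite ler_wpM2l //; lra.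
by nra.
Qed.

End Procedure.

(** * Almost sure success and the final bound *)

Lemma exists_expr_le (R : realType) (d e : R) : 0 < d <= 1 -> 0 < e ->
  exists L, (1 - d) ^+ L <= e.
Proof.
move=> /andP[d0 d1] e0.
have bern L : (1 - d) ^+ L * (1 + L%:R * d) <= 1.
  elim: L => [|L IH]; first by rewrite expr0 mul0r addr0 mulr1.
  have xL : 0 <= (1 - d) ^+ L by rewrite exprn_ge0 // subr_ge0.
  apply: le_trans IH; rewrite exprSr -mulrA ler_wpM2l // -natr1.
  by have := ler0n R L; nra.
(* As [L d e >= 1], a power above [e] would make the product in [bern] exceed [e + 1]. *)
exists (Num.truncn (d * e)^-1).+1; set L := _.+1.
have de : 1 <= (d * e) * L%:R.
  by rewrite -ler_pdivrMl ?mulr_gt0 // mulr1 ltW // truncnS_gt.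
rewrite leNgt; apply/negP => lt; have := bern L.
have L0 : 0 <= L%:R :> R by exact: ler0n.
by move: ((1 - d) ^+ L) lt => x lt; nra.
Qed.

Section Search.
Context {R : realType} (n : nat) (f : 'I_(2 ^ n) -> bool).
Hypothesis matches : (1 <= #|[set i | f i]%SET| <= 2 ^ n)%N.

Lemma match_ratio_range : 0 < (match_ratio f : R) <= 1.
Proof.
have /andP[M1 MN] := matches; have N0 := natr_exp2_gt0 (R := R) n.
apply/andP; split; first by rewrite divr_gt0 // ltr0n.
by rewrite ler_pdivrMr // mul1r ler_nat.
Qed.

Let y : R := 1 - match_ratio f.

Lemma miss_ratio_range : 0 <= y < 1.
Proof. by have := match_ratio_range; rewrite /y; lra. Qed.

Lemma prob_find_match_eq1 (lambda : R) : 1 <= lambda ->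
  prob_find_match lambda f = 1%E.
Proof.
move=> l1; have y01 := miss_ratio_range; have /andP[y0 y1] := y01.
pose b := (Num.truncn (Num.sqrt (2 ^ n)%:R : R)).+1.
have R1 : 1 <= (1 : R) <= Num.sqrt (2 ^ n)%:R by rewrite lexx sqrtN_ge1.
apply/eqP; rewrite eq_le; apply/andP; split.
  apply: (@esum_short_runs_le _ _ _ _ _ b) => [s|B L bB].
    exact: run_prob_ge0.
  exact: mass_le1.
apply/lee_addgt0Pr => e e0.
have d01 : 0 < (1 - y) / (1 + y) <= 1.
  by rewrite divr_gt0 ?ler_pdivrMr; lra.
have [L Le] := exists_expr_le d01 e0.
have h := esum_short_runs_ge (S := [set s | outputs_match f s]%classic) b L
  (@run_prob_outputs _ _ f lambda 1).
apply: le_trans (leeD2r e%:E h); rewrite -EFinD lee_fin.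
have /andP[_] := mass_range l1 (ltnSn _) y01 L R1.
by rewrite /mass -/y -/b; lra.
Qed.

Lemma expected_iterations_le :
  (expected_iterations (8 / 7 : R) f <=
   (64 * Num.sqrt ((2 ^ n)%:R / #|[set i | f i]%SET|%:R))%:E)%E.
Proof.
have l1 : 1 <= 8 / 7 :> R by lra.
have /andP[M1 MN] := matches; have N0 := natr_exp2_gt0 (R := R) n.
have M1R : 1 <= #|[set i | f i]%SET|%:R :> R by rewrite ler1n.
set u := Num.sqrt _.
have uR : 1 <= u <= Num.sqrt (2 ^ n)%:R.
  rewrite -[X in X <= u]sqrtr1 !ler_wsqrtr //.
    by rewrite ler_pdivrMr ?ler_peMr //; lra.
  by rewrite ler_pdivlMr ?mul1r ?ler_nat //; lra.
have ut : u ^+ 2 * match_ratio f = 1.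
  rewrite sqr_sqrtr ?divr_ge0 ?ler0n // /match_ratio.
  by field; rewrite !gt_eqF //; lra.
have R1 : 1 <= (1 : R) <= Num.sqrt (2 ^ n)%:R by rewrite lexx sqrtN_ge1.
pose b := (Num.truncn (Num.sqrt (2 ^ n)%:R : R)).+1.
apply: (@esum_short_runs_le _ _ _ _ _ b) => [s|B L bB].
  by rewrite mulr_ge0 ?ler0n ?run_prob_ge0.
(* At the initial value [m = 1] the potential is 49 or [64 u - 7]; both are at most [64 u] because
   [u >= 1]. *)
apply: le_trans (cost_potential L bB miss_ratio_range uR ut R1) _.
by have /andP[u1 _] := uR; case: ifP => _; lra.
Qed.

End Search.

Theorem mainTheorem3 (R : realType) :
  exists C : R, 0 < C /\
    forall (n : nat) (f : 'I_(2 ^ n) -> bool),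
      (1 <= n)%N ->
      (1 <= #|[set i | f i]%SET| <= 2 ^ n)%N ->
      prob_find_match (8 / 7 : R) f = 1%E /\
      (expected_iterations (8 / 7 : R) f <=
         (C * Num.sqrt ((2 ^ n)%:R / #|[set i | f i]%SET|%:R))%:E)%E.
Proof.
exists 64; split=> [|n f _ matches]; first lra.
split; last exact: expected_iterations_le.
by apply: prob_find_match_eq1 => //; lra.
Qed.
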